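(* For $n\in\mathbb{N}$, the number of lattice points in the interior or on the boundary of a circle of radius $\sqrt{2n}$ centered at the origin is $4\mathcal{R}_n+4n+1$. That is, $$\#\{(a,b)\in\mathbb{Z}^2 : a^2+b^2\le 2n\}=4\mathcal{R}_n+4n+1.$$
   Context: $\mathbb{N}$ denotes the set of positive integers. The nearest integer function $\mathrm{nint}$ rounds a real number to the nearest integer, with half-integers rounded up: $\mathrm{nint}(x)=\max\{z\in\mathbb{Z} : |z-x|\le |z'-x|\text{ for all } z'\in\mathbb{Z}\}=\lfloor x+1/2\rfloor$. For $n\in\mathbb{N}$, $\mathcal{R}_n = \#\{k\in\mathbb{Z} : 1\le k\le n,\ \mathrm{nint}(n/k)\text{ is odd}\}$. *)

(* Defs.v *)
From mathcomp Require Import all_boot all_order all_algebra.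
From mathcomp Require Import all_classical all_reals.
From mathcomp Require Import lra.
Set Implicit Arguments.
Unset Strict Implicit.
Unset Printing Implicit Defensive.
Import Order.TTheory GRing.Theory Num.Theory.
Local Open Scope ring_scope.

Definition nint (R : realType) (x : R) : int := Num.floor (x + 2^-1).

Definition closest_int (R : realType) (x : R) (z : int) : Prop :=
  forall y : int, `|z%:~R - x| <= `|y%:~R - x|.

(* [nint x] is the largest of the integers closest to [x]. *)
Lemma nintP (R : realType) (x : R) (z : int) :
  z = nint x <->
  closest_int x z /\ (forall w : int, closest_int x w -> w <= z).
Proof.
have /andP[f1 f2] := floor_itv (x + 2^-1).
rewrite -/(nint x) in f1 f2; rewrite intrD in f2.
have near : closest_int x (nint x).
  move=> y; case: (ltgtP y (nint x)) => [lt_y|gt_y|-> //].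
    have h : y%:~R + 1 <= (nint x)%:~R :> R by rewrite -(intrD _ y 1) ler_int lezD1.
    rewrite ler_norml; apply/andP; split; rewrite ler0_norm; lra.
  have h : (nint x)%:~R + 1 <= y%:~R :> R by rewrite -(intrD _ _ 1) ler_int lezD1.
  rewrite ler_norml; apply/andP; split; rewrite ger0_norm; lra.
have max w : closest_int x w -> w <= nint x.
  move=> cw; rewrite leNgt; apply/negP => gt_w.
  have h : (nint x)%:~R + 1 <= w%:~R :> R by rewrite -(intrD _ _ 1) ler_int lezD1.
  by have := cw (nint x); apply/negP; rewrite -ltNge ltr_norml;
    apply/andP; split; rewrite ger0_norm; lra.
split=> [->|[cz mz]]; first by split.
by apply/le_anti; rewrite max //= mz.
Qed.

Definition odd_nint_count (R : realType) (n : nat) : nat :=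
  (\sum_(1 <= k < n.+1 | ~~ (2 %| nint (n%:R / k%:R : R))%Z) 1)%N.

Definition lattice_points_in_disc (R : realType) (r : R) : set (int * int) :=
  [set p | Num.sqrt (p.1%:~R ^+ 2 + p.2%:~R ^+ 2) <= r]%classic.

(* Main.v *)
(** Jacobi's two-square theorem, r(m) = 4 * sum_{d | m} chi(d) for m > 0 with chi the
    nontrivial character mod 4, reduces the claim to a divisor sum: writing m = k d and
    summing over d <= 2n/k, each k <= 2n contributes 1 exactly when floor(2n/k) is 1 or 2
    mod 4.  For k <= n this says that nint(n/k) = floor((floor(2n/k) + 1)/2) is odd, and
    the n values k > n all contribute since then floor(2n/k) = 1.

    Jacobi's theorem is proved by showing that r and the divisor sum E (with E(0) = 1)
    satisfy the same recurrence
      sum_i (-1)^i f(n - i^2) = sum_{i^2 + 2m = n} (-1)^m f(m)     (n > 0),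
    which determines f(n) from smaller values; in generating functions it is
    theta(-q) f(q) = theta(q) f(-q^2).  For r = theta^2 it follows from
    theta(q) theta(-q) = theta(-q^2)^2, i.e. from (a, b) = (u + v, u - v).  For E it is
    Liouville's elementary method: on solutions of i^2 + d e = n, the substitution
    (i, d, e) -> (i + d, d, e - 2i - d) is compared with symmetries of the equation.  *)

Require Import Defs.
From mathcomp Require Import all_boot all_order all_algebra.
From mathcomp Require Import all_classical all_reals.
From mathcomp Require Import finmap zify ring.
Import Order.TTheory GRing.Theory Num.Theory.
Local Open Scope classical_set_scope.
Local Open Scope card_scope.
Local Open Scope ring_scope.

(** * Signs and the character mod 4 *)

Definition sg (i : int) : int := if (2 %| i)%Z then 1 else -1.

Definition chi (d : int) : int :=
  if (d %% 4)%Z == 1 then 1 else if (d %% 4)%Z == 3 then -1 else 0.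

Lemma chiN d : chi (- d) = - chi d.
Proof. rewrite /chi; do ?case: ifP => ?; lia. Qed.

Lemma chi_even d : (2 %| d)%Z -> chi d = 0.
Proof. rewrite /chi; do ?case: ifP => ?; lia. Qed.

(** Over a period [chi] takes the values 1, 0, -1, 0, so its partial sums cycle through 1, 1, 0,
    0. *)
Lemma sum_chi (c : nat) : \sum_(1 <= k < c.+1) chi k = ((c %% 4)%N \in [:: 1%N; 2%N])%:Z.
Proof.
elim: c => [|c IH]; first by rewrite big_geq.
rewrite big_nat_recr//= IH /chi !inE.
by do ?case: ifP => ?; lia.
Qed.

Lemma chiD2 d i : chi (d + 2 * i) = sg i * chi d.
Proof. rewrite /chi /sg; do ?case: ifP => ?; lia. Qed.

Lemma int_parity (u : int) : exists k, u = 2 * k \/ u = 2 * k + 1.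
Proof. exists (u %/ 2)%Z; lia. Qed.

Lemma sgM_odd d e : ~~ (2 %| d)%Z -> sg (d * e) = sg e.
Proof.
case: (int_parity d) => k [] ->; first lia.
by move=> _; rewrite /sg; congr (if _ then _ else _); lia.
Qed.

Lemma sg_sqr u v : sg (u ^+ 2 + v ^+ 2) = sg (u + v).
Proof.
rewrite /sg; congr (if _ then _ else _).
by case: (int_parity u) => k [] ->; case: (int_parity v) => l [] ->; lia.
Qed.

Lemma ler_norm_sqr (i : int) : `|i| <= i ^+ 2.
Proof. by have [->|i0] := eqVneq i 0; last nia. Qed.

(** * Change of variables in finite sums over boxes *)

(* Infinite sums over the integers are cut off to [-B, B], with B large enough that no
   solution of the equations below is lost. *)
Definition box (B : nat) : seq int := [seq k%:Z - B%:Z | k <- iota 0 (2 * B).+1].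
Arguments box B : simpl never.

Lemma mem_box B i : (i \in box B) = (`|i| <= B%:Z).
Proof.
apply/mapP/idP => [[k]|hi]; first by rewrite mem_iota => hk ->; lia.
exists (absz (i + B%:Z)); last lia.
by rewrite mem_iota; lia.
Qed.

Lemma box_uniq B : uniq (box B).
Proof. by rewrite map_inj_uniq ?iota_uniq// => j k; lia. Qed.

(** [h] and [h'] need to be mutually inverse only on the two summation ranges, so that halving can
    serve as a change of variables. *)
Lemma big_bij (T U : eqType) (s : seq T) (t : seq U) (P : pred T) (Q : pred U)
    (h : T -> U) (h' : U -> T) (F : T -> int) (G : U -> int) :
  uniq s -> uniq t ->
  (forall x, x \in s -> P x ->
     [/\ h x \in t, Q (h x), h' (h x) = x & F x = G (h x)]) ->
  (forall y, y \in t -> Q y -> [/\ h' y \in s, P (h' y) & h (h' y) = y]) ->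
  \sum_(x <- s | P x) F x = \sum_(y <- t | Q y) G y.
Proof.
move=> us ut hst hts.
rewrite -[LHS]big_filter -[RHS]big_filter.
have e : perm_eq [seq y <- t | Q y] (map h [seq x <- s | P x]).
  apply: uniq_perm; first exact: filter_uniq.
    rewrite map_inj_in_uniq ?filter_uniq// => x y.
    rewrite !mem_filter => /andP[Px xs] /andP[Py ys] e.
    have [_ _ <- _] := hst _ xs Px; have [_ _ <- _] := hst _ ys Py.
    by rewrite e.
  move=> y; rewrite mem_filter; apply/andP/mapP => [[Qy yt]|[x]].
    have [h1 h2 h3] := hts _ yt Qy.
    by exists (h' y); rewrite // mem_filter h2.
  by rewrite mem_filter => /andP[Px xs] ->; have [] := hst _ xs Px.
rewrite (perm_big _ e) big_map big_seq [RHS]big_seq; apply: eq_bigr => x.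
by rewrite mem_filter => /andP[Px xs]; have [] := hst _ xs Px.
Qed.

Lemma sum_box_nat B (c : nat) (F : int -> int) : (c <= B)%N ->
  \sum_(d <- box B | (0 < d) && (d <= c%:Z)) F d = \sum_(1 <= k < c.+1) F k%:Z.
Proof.
move=> cB; rewrite [RHS]big_seq.
apply: (@big_bij _ _ _ _ _ _ absz Posz); rewrite ?box_uniq ?iota_uniq//.
  move=> d; rewrite mem_box mem_index_iota => ? ?.
  have e : (absz d)%:Z = d by lia.
  by split=> //; rewrite ?e//; lia.
by move=> k; rewrite mem_index_iota mem_box => *; split; lia.
Qed.

Lemma mem_pairs (T U : eqType) (s : seq T) (t : seq U) x y :
  ((x, y) \in [seq (a, b) | a <- s, b <- t]) = (x \in s) && (y \in t).
Proof.
apply/allpairsP/andP => [[[a b] [/= ? ? [-> ->]]] //|[xs yt]].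
by exists (x, y).
Qed.

Definition box2 (B : nat) := [seq (d, e) | d <- box B, e <- box B].
Arguments box2 B : simpl never.
Definition box3 (B : nat) := [seq (i, x) | i <- box B, x <- box2 B].
Arguments box3 B : simpl never.

Lemma mem_box2 B d e : ((d, e) \in box2 B) = (`|d| <= B%:Z) && (`|e| <= B%:Z).
Proof. by rewrite mem_pairs !mem_box. Qed.

Lemma mem_box3 B i d e :
  ((i, (d, e)) \in box3 B) = [&& `|i| <= B%:Z, `|d| <= B%:Z & `|e| <= B%:Z].
Proof. by rewrite !mem_pairs !mem_box. Qed.

Lemma box2_uniq B : uniq (box2 B).
Proof. by rewrite allpairs_uniq ?box_uniq// => -[? ?] []. Qed.

Lemma box3_uniq B : uniq (box3 B).
Proof. by rewrite allpairs_uniq ?box_uniq ?box2_uniq// => -[? ?] []. Qed.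

Lemma sum_box2 B (P : pred (int * int)) (F : int * int -> int) :
  \sum_(x <- box2 B | P x) F x =
  \sum_(d <- box B) \sum_(e <- box B | P (d, e)) F (d, e).
Proof.
rewrite big_mkcond big_allpairs; apply: eq_bigr => d _.
by rewrite [RHS]big_mkcond.
Qed.

(** Each x lies over the single value m = [g x]; the test [|g y.2| <= B] is what remains of the
    range of m. *)
Lemma sum_fibers (T : eqType) B (s : seq T) (P : pred T) (g : T -> int) (w : T -> int)
    (Q : int -> pred int) (v : int -> int -> int) (t : seq int) :
  \sum_(i <- t) \sum_(m <- box B | Q i m)
     v i m * (\sum_(x <- s | P x && (g x == m)) w x) =
  \sum_(y <- [seq (i, x) | i <- t, x <- s] |
      [&& P y.2, `|g y.2| <= B%:Z & Q y.1 (g y.2)]) v y.1 (g y.2) * w y.2.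
Proof.
rewrite [RHS]big_mkcond big_allpairs; apply: eq_bigr => i _ /=.
under eq_bigr do rewrite big_distrr /=.
rewrite (exchange_big_dep P) /=; last by move=> ? ? _ /andP[].
rewrite big_mkcond; apply: eq_bigr => x _.
case: (P x) => //=.
rewrite -mem_box; have [gB|gB] := boolP (g x \in box B); last first.
  rewrite big_seq_cond big1// => m /and3P[mB _ /eqP e].
  by rewrite e mB in gB.
rewrite big_mkcond (bigD1_seq (g x)) ?box_uniq//= eqxx andbT.
by rewrite big1 ?addr0// => m; rewrite eq_sym => /negPf ->; rewrite andbF.
Qed.

(** * Liouville's identity *)

Section Liouville.
Variables (B : nat) (n : int).
Hypothesis nB : 4 * n <= B%:Z.

Local Notation triple := (int * (int * int))%type.

Let sol : pred triple := fun t =>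
  [&& 0 < t.2.1, 0 < t.2.2 & t.1 ^+ 2 + t.2.1 * t.2.2 == n].

(** The image of [sol] under (i, d, e) -> (i + d, d, e - 2i - d); the second inequality says that
    the original e is positive. *)
Let shifted : pred triple := fun t =>
  [&& 0 < t.2.1, 0 < t.2.2 + 2 * t.1 - t.2.1 & t.1 ^+ 2 + t.2.1 * t.2.2 == n].

Lemma sol_bounds t : sol t -> [&& `|t.1| <= n, t.2.1 <= n & t.2.2 <= n].
Proof.
case: t => i [d e]; rewrite /sol /= => /and3P[d0 e0 /eqP h].
have : d * e >= d by nia.
have : d * e >= e by nia.
have := ler_norm_sqr i.
have := sqr_ge0 i.
lia.
Qed.

Lemma sum_sol_shifted :
  \sum_(t <- box3 B | sol t) chi (t.2.2 - 2 * t.1) =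
  \sum_(t <- box3 B | shifted t) chi (t.2.1 + t.2.2).
Proof.
apply: (@big_bij _ _ _ _ _ _
  (fun t => (t.1 + t.2.1, (t.2.1, t.2.2 - 2 * t.1 - t.2.1)))
  (fun t => (t.1 - t.2.1, (t.2.1, t.2.2 + 2 * t.1 - t.2.1))));
  rewrite ?box3_uniq// => -[i [d e]] _ /=.
  move=> h; have /= := sol_bounds _ h; move: h; rewrite /sol /shifted /= mem_box3.
  move=> /and3P[h1 h2 /eqP h3] h4.
  (* The factor 4 in [nB] leaves room for e - 2i - d. *)
  split; first lia.
  - apply/and3P; split; [lia|lia|apply/eqP; rewrite -h3; ring].
  - congr (_, (_, _)); ring.
  - congr chi; ring.
move=> h.
have h' : sol (i - d, (d, e + 2 * i - d)).
  move: h; rewrite /sol /shifted /= => /and3P[h1 h2 /eqP h3].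
  by apply/and3P; split; [lia|lia|apply/eqP; rewrite -h3; ring].
have /= := sol_bounds _ h'; rewrite mem_box3.
move: h'; rewrite /sol /= => /and3P[h1 h2 /eqP h3] h4.
split; [lia|by apply/and3P; split=> //; apply/eqP|].
by congr (_, (_, _)); ring.
Qed.

(* [(d, e) -> (- e, - d)] preserves [shifted] and changes the sign of [d + e]. *)
Lemma sum_shifted_neg :
  \sum_(t <- box3 B | shifted t && (t.2.2 < 0)) chi (t.2.1 + t.2.2) = 0.
Proof.
set Z := LHS; suff : Z = - Z by lia.
rewrite /Z -sumrN.
apply: (@big_bij _ _ _ _ _ _
  (fun t => (t.1, (- t.2.2, - t.2.1))) (fun t => (t.1, (- t.2.2, - t.2.1))));
  rewrite ?box3_uniq// => -[i [d e]] /=; rewrite /shifted !mem_box3 /=.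
  move=> hb /andP[/and3P[h1 h2 /eqP h3] h4]; split; first lia.
  - by rewrite -h3; lia.
  - by congr (_, (_, _)); ring.
  - by rewrite -chiN; congr chi; ring.
move=> hb /andP[/and3P[h1 h2 /eqP h3] h4]; split; first lia.
- by rewrite -h3; lia.
- by congr (_, (_, _)); ring.
Qed.

(* [(i, d, e) -> (- i, e, d)] exchanges the solutions with [d - e < 2 i] and those with
   [d - e > 2 i]; when [d - e = 2 i] the summand vanishes, as [d + e] is even. *)
Lemma sum_shifted_pos :
  \sum_(t <- box3 B | sol t) chi (t.2.1 + t.2.2) =
  2 * \sum_(t <- box3 B | shifted t && (0 < t.2.2)) chi (t.2.1 + t.2.2).
Proof.
rewrite (bigID (fun t => t.2.1 - t.2.2 < 2 * t.1)) /=.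
set X := RHS; rewrite mulr_natl mulr2n in X *.
rewrite /X; congr (_ + _).
  (* When e > 0, [shifted] is [sol] together with d - e < 2i. *)
  apply: eq_bigl => -[i [d e]]; rewrite /sol /shifted /=; lia.
rewrite (bigID (fun t => 2 * t.1 < t.2.1 - t.2.2)) /= addrC big1 ?add0r; last first.
  case=> i [d e] /= /andP[/andP[_ h1] h2]; apply: chi_even; lia.
apply: (@big_bij _ _ _ _ _ _
  (fun t => (- t.1, (t.2.2, t.2.1))) (fun t => (- t.1, (t.2.2, t.2.1))));
  rewrite ?box3_uniq// => -[i [d e]] /=; rewrite /sol /shifted !mem_box3 /=.
  move=> hb /andP[/andP[/and3P[h1 h2 /eqP h3] h4] h5]; split; first lia.
  - by rewrite -h3; lia.
  - by congr (_, (_, _)); ring.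
  - by congr chi; ring.
move=> hb /andP[/and3P[h1 h2 /eqP h3] h4]; split; first lia.
- by rewrite -h3; lia.
- by congr (_, (_, _)); ring.
Qed.

(* Only one of [d], [e] being even contributes, and then [chi (d + 2 e) = (-1)^e chi d]. *)
Lemma sum_sol_even :
  \sum_(t <- box3 B | sol t) chi (t.2.1 + t.2.2) =
  2 * \sum_(t <- box3 B |
         [&& 0 < t.2.1, 0 < t.2.2 & t.1 ^+ 2 + 2 * (t.2.1 * t.2.2) == n])
        sg (t.2.1 * t.2.2) * chi t.2.2.
Proof.
rewrite [in RHS](bigID (fun t => (2 %| t.2.2)%Z)) /=.
rewrite [X in _ = _ * (X + _)]big1 ?add0r; last first.
  by case=> i [d e] /= /andP[_ h1]; rewrite chi_even ?mulr0.
set X := RHS; rewrite mulr_natl mulr2n in X *; rewrite {}/X.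
have halves i d e : [&& 0 < d, 0 < e & i ^+ 2 + 2 * (d * e) == n] ->
    [&& `|i| <= B%:Z, `|2 * d| <= B%:Z & `|e| <= B%:Z].
  move=> /and3P[h1 h2 /eqP h3].
  have /= : [&& `|i| <= n, 2 * d <= n & e <= n]; last lia.
  by apply: (sol_bounds (i, (2 * d, e))); rewrite /sol /=; lia.
(* One copy of the right-hand sum comes from even d, the other from even e. *)
rewrite (bigID (fun t => (2 %| t.2.1)%Z)) /=; congr (_ + _).
  rewrite (bigID (fun t => (2 %| t.2.2)%Z)) /= big1 ?add0r; last first.
    case=> i [d e] /= /andP[/andP[_ h1] h2]; apply: chi_even; lia.
  apply: (@big_bij _ _ _ _ _ _
    (fun t => (t.1, ((t.2.1 %/ 2)%Z, t.2.2))) (fun t => (t.1, (2 * t.2.1, t.2.2))));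
    rewrite ?box3_uniq// => -[i [d e]] /=; rewrite /sol !mem_box3 /=.
    move=> hb /andP[/andP[/and3P[h1 h2 /eqP h3] h4] h5].
    case: (int_parity d) => k [] ?; subst d; last lia.
    have -> : (2 * k %/ 2)%Z = k by lia.
    split; [lia | | by [] | ].
    + by rewrite h5 andbT; apply/and3P; split; [lia|lia|apply/eqP; rewrite -h3; ring].
    + by rewrite addrC chiD2 [k * e]mulrC sgM_odd.
  move=> hb /andP[h h4]; split; first exact: halves.
  - by move: h => /and3P[h1 h2 /eqP h3]; rewrite h4 andbT -h3; lia.
  - by congr (_, (_, _)); lia.
rewrite (bigID (fun t => (2 %| t.2.2)%Z)) /= addrC big1 ?add0r; last first.
  case=> i [d e] /= /andP[/andP[_ h1] h2]; apply: chi_even; lia.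
apply: (@big_bij _ _ _ _ _ _
  (fun t => (t.1, ((t.2.2 %/ 2)%Z, t.2.1))) (fun t => (t.1, (t.2.2, 2 * t.2.1))));
  rewrite ?box3_uniq// => -[i [d e]] /=; rewrite /sol !mem_box3 /=.
  move=> hb /andP[/andP[/and3P[h1 h2 /eqP h3] h4] h5].
  case: (int_parity e) => k [] ?; subst e; last lia.
  have -> : (2 * k %/ 2)%Z = k by lia.
  split; [lia | | by [] | ].
  + by rewrite h4 andbT; apply/and3P; split; [lia|lia|apply/eqP; rewrite -h3; ring].
  + by rewrite chiD2 [k * d]mulrC sgM_odd.
move=> hb /andP[h h4]; split; first by have := halves _ _ _ h; lia.
- by move: h => /and3P[h1 h2 /eqP h3]; rewrite h4 -h3; lia.
- by congr (_, (_, _)); lia.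
Qed.

(** For e = 0 the conditions are i^2 = n and 0 < d < 2i. The end point d = 2i may be added since
    [chi] vanishes there, and the sum of [chi] up to 2i is 1 or 0 as i is odd or even. Four times
    this is 2 (1 - sg i), shared between i and -i. *)
Lemma sum_shifted_zero :
  4 * \sum_(t <- box3 B | shifted t && (t.2.2 == 0)) chi (t.2.1 + t.2.2) =
  \sum_(i <- box B | i ^+ 2 == n) (1 - sg i).
Proof.
transitivity (4 * \sum_(i <- box B | (0 < i) && (i ^+ 2 == n))
                \sum_(d <- box B | (0 < d) && (d <= (2 * i))) chi d).
  congr (_ * _).
  rewrite big_mkcond big_allpairs [RHS]big_mkcond; apply: eq_bigr => i _.
  rewrite big_allpairs exchange_big /= (bigD1_seq 0) ?box_uniq ?mem_box//=.
  rewrite [X in _ + X]big1 ?addr0; last first.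
    by move=> e /negPf e0; rewrite big1// => d _; rewrite e0 andbF.
  rewrite [in RHS]big_mkcond.
  case: ifP => [/andP[i0 hi]|hi]; last first.
    rewrite big1// => d _; case: ifP => // /=.
    by rewrite /shifted /= mulr0 addr0 add0r andbT; lia.
  apply: eq_bigr => d _; rewrite /shifted /= mulr0 !addr0 add0r hi !andbT.
  case: (0 < d) => //=.
  by case: ifP => ?; case: ifP => ? //; rewrite chi_even//; lia.
rewrite [RHS](bigID (fun i => 0 < i)) /=.
rewrite [X in _ = _ + X](_ : _ =
  \sum_(i <- box B | (i ^+ 2 == n) && (0 < i)) (1 - sg i)); last first.
  rewrite (bigID (fun i => i == 0)) /= big1 ?add0r; last first.
    by move=> i /andP[_ /eqP ->].
  apply: (@big_bij _ _ _ _ _ _ (fun i => - i) (fun i => - i)); rewrite ?box_uniq// => i;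
    rewrite !mem_box.
    move=> ib /andP[/andP[/eqP h1 h2] h3].
    split; [lia| |lia|].
      by rewrite sqrrN h1 eqxx; lia.
    by rewrite /sg; congr (1 - (if _ then _ else _)); lia.
  move=> ib /andP[/eqP h1 h2]; split; [lia| |lia].
  by rewrite sqrrN h1 eqxx; lia.
set X := \sum_(_ <- _ | _) \sum_(_ <- _ | _) _; set Y := \sum_(_ <- _ | _) _.
suff : 2 * X = Y by lia.
rewrite /X /Y big_distrr /=; under [RHS]eq_bigl do rewrite andbC.
apply: eq_bigr => i /andP[i0 /eqP hi].
have hb : 2 * i <= B%:Z by nia.
rewrite (_ : 2 * i = (2 * absz i)%N%:Z); last lia.
rewrite sum_box_nat; last lia.
by rewrite sum_chi !inE /sg; case: ifP => ?; lia.
Qed.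

(** The shifted sum splits by the sign of e: e > 0 gives the sum on the right, e = 0 gives the
    squares, e < 0 cancels. This is the recurrence for E, with E(0) = 1 accounting for the sums over
    i^2 = n. *)
Lemma liouville_identity :
  4 * \sum_(t <- box3 B | sol t) sg t.1 * chi t.2.2 + \sum_(i <- box B | i ^+ 2 == n) sg i =
  4 * \sum_(t <- box3 B |
         [&& 0 < t.2.1, 0 < t.2.2 & t.1 ^+ 2 + 2 * (t.2.1 * t.2.2) == n])
        sg (t.2.1 * t.2.2) * chi t.2.2 + \sum_(i <- box B | i ^+ 2 == n) 1.
Proof.
have := sum_sol_shifted; under eq_bigr do rewrite -mulrN chiD2.
have -> : \sum_(t <- box3 B | sol t) sg (- t.1) * chi t.2.2 =
          \sum_(t <- box3 B | sol t) sg t.1 * chi t.2.2.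
  apply: eq_bigr => t _; congr (_ * _).
  by rewrite /sg; congr (if _ then _ else _); lia.
rewrite [RHS](bigID (fun t => 0 < t.2.2)) /= [X in _ = _ + X](bigID (fun t => t.2.2 == 0)) /=.
under [X in _ = _ + (X + _)]eq_bigl => t.
  rewrite -andbA (_ : ~~ (0 < t.2.2) && (t.2.2 == 0) = (t.2.2 == 0)); last lia.
  over.
under [X in _ = _ + (_ + X)]eq_bigl => t.
  rewrite -andbA (_ : ~~ (0 < t.2.2) && (t.2.2 != 0) = (t.2.2 < 0)); last lia.
  over.
rewrite sum_shifted_neg addr0.
have := sum_shifted_zero; rewrite sumrB.
have := sum_shifted_pos; rewrite sum_sol_even => /mulfI -> // e ->.
by rewrite mulrDr e -addrA subrK.
Qed.

End Liouville.

(** * The recurrence and Jacobi's two-square theorem *)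

(* The trivial guard [true] matches the shape of [sum_fibers] and [sum_levels]. *)
Definition repr (B : nat) (m : int) : int :=
  \sum_(x <- box2 B | true && (x.1 ^+ 2 + x.2 ^+ 2 == m)) 1.

Definition divchi (B : nat) (m : int) : int :=
  \sum_(x <- box2 B | (0 < x.1) && (0 < x.2) && (x.1 * x.2 == m)) chi x.2.

(** The coefficient of q^n in theta(-q) f(q) - theta(q) f(-q^2), up to truncation. *)
Definition theta_defect (B : nat) (f : int -> int) (n : int) : int :=
  \sum_(i <- box B) \sum_(m <- box B | i ^+ 2 + m == n) sg i * f m -
  \sum_(i <- box B) \sum_(m <- box B | i ^+ 2 + 2 * m == n) sg m * f m.

Lemma sum_sqr_le B n (a b c : int) : 4 * n <= B%:Z ->
  a ^+ 2 + (b ^+ 2 + c ^+ 2) = n -> `|b ^+ 2 + c ^+ 2| <= B%:Z.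
Proof. by have := sqr_ge0 a; have := sqr_ge0 b; have := sqr_ge0 c; lia. Qed.

(** In i^2 + a^2 + b^2 = n, the terms with i + a odd cancel under swapping i and a. The others are i
    = u + v, a = u - v, so that i^2 + a^2 = 2 (u^2 + v^2) and sg i = sg (u^2 + v^2). *)
Lemma theta_defect_repr B n : 4 * n <= B%:Z -> theta_defect B (repr B) n = 0.
Proof.
move=> nB; apply/eqP; rewrite subr_eq0; apply/eqP.
rewrite /repr !sum_fibers -/(box3 B) /=.
under eq_bigr do rewrite mulr1; under [RHS]eq_bigr do rewrite mulr1 sg_sqr.
rewrite (bigID (fun t => (2 %| t.1 + t.2.1)%Z)) /= [X in _ + X](_ : _ = 0) ?addr0; last first.
  set Z := LHS; suff : Z = - Z by lia.
  rewrite /Z -sumrN.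
  apply: (@big_bij _ _ _ _ _ _
    (fun t => (t.2.1, (t.1, t.2.2))) (fun t => (t.2.1, (t.1, t.2.2))));
    rewrite ?box3_uniq// => -[i [a b]] /=; rewrite !mem_box3 /=.
    move=> h1 /andP[/andP[h2 /eqP h3] h4]; split=> //; [lia| |].
      have := sqr_ge0 i; have := sqr_ge0 a; have := sqr_ge0 b.
      move=> ? ? ?; apply/andP; split; last lia.
      apply/andP; split; [lia|apply/eqP; rewrite -h3; ring].
    by rewrite /sg; do ?case: ifP => ?; lia.
  move=> h1 /andP[/andP[h2 /eqP h3] h4]; split=> //; [lia|].
  have := sqr_ge0 i; have := sqr_ge0 a; have := sqr_ge0 b.
  move=> ? ? ?; apply/andP; split; last lia.
  apply/andP; split; [lia|apply/eqP; rewrite -h3; ring].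
apply: (@big_bij _ _ _ _ _ _
    (fun t => (t.2.2, ((((t.1 + t.2.1)) %/ 2)%Z, ((t.1 - t.2.1) %/ 2)%Z)))
    (fun t => (t.2.1 + t.2.2, (t.2.1 - t.2.2, t.1))));
    rewrite ?box3_uniq// => -[i [a b]] /=; rewrite !mem_box3 /=.
  move=> h1 /andP[/andP[h2 /eqP h3] h4].
  have [u [v [ei ea]]] : exists u v, i = u + v /\ a = u - v.
    by exists ((i + a) %/ 2)%Z, ((i - a) %/ 2)%Z; lia.
  subst i a.
  have -> : ((u + v + (u - v)) %/ 2)%Z = u by lia.
  have -> : ((u + v - (u - v)) %/ 2)%Z = v by lia.
  split=> //; first lia.
  have := sqr_ge0 u; have := sqr_ge0 v; have := sqr_ge0 b => ? ? ?.
  apply/andP; split; last by apply/eqP; rewrite -h3; ring.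
  have e : 2 * (u ^+ 2 + v ^+ 2) + b ^+ 2 = n by rewrite -h3; ring.
  clear h2 h3; lia.
move=> h1 /andP[h2 /eqP h3].
have := sqr_ge0 i; have := sqr_ge0 a; have := sqr_ge0 b => ? ? ?.
have := ler_norm_sqr a; have := ler_norm_sqr b => ? ?.
split; first lia.
- have e : (a + b) ^+ 2 + ((a - b) ^+ 2 + i ^+ 2) = n by rewrite -h3; ring.
  apply/andP; split; last by clear; lia.
  by rewrite e eqxx andbT (sum_sqr_le _ _ _ _ _ nB e).
- by congr (_, (_, _)); lia.
Qed.

(** This is E; [divchi] vanishes at 0, so the first term supplies E(0) = 1. *)
Definition jacobi (B : nat) (m : int) : int := (m == 0)%:Z + 4 * divchi B m.

Lemma theta_defect_linear B (f g : int -> int) c n :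
  theta_defect B (fun m => f m + c * g m) n =
  theta_defect B f n + c * theta_defect B g n.
Proof.
have lin (P : int -> int -> bool) (v : int -> int -> int) :
    \sum_(i <- box B) \sum_(m <- box B | P i m) v i m * (f m + c * g m) =
    \sum_(i <- box B) \sum_(m <- box B | P i m) v i m * f m +
    c * \sum_(i <- box B) \sum_(m <- box B | P i m) v i m * g m.
  rewrite big_distrr -big_split; apply: eq_bigr => i _ /=.
  by rewrite big_distrr -big_split; apply: eq_bigr => m _ /=; ring.
rewrite /theta_defect (lin _ (fun i _ => sg i)) (lin _ (fun _ m => sg m)); ring.
Qed.

Lemma theta_defect_delta B n : theta_defect B (fun m => (m == 0)%:Z) n =
  \sum_(i <- box B | i ^+ 2 == n) sg i - \sum_(i <- box B | i ^+ 2 == n) 1.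
Proof.
by congr (_ - _); rewrite [RHS]big_mkcond; apply: eq_bigr => i _;
  rewrite big_mkcond (bigD1_seq 0) ?box_uniq ?mem_box//=;
  rewrite ?mulr0 ?addr0 big1 ?addr0 ?mulr1// => m /negPf ->; rewrite mulr0 if_same.
Qed.

Lemma theta_defect_jacobi B n : 4 * n <= B%:Z -> theta_defect B (jacobi B) n = 0.
Proof.
move=> nB; rewrite theta_defect_linear theta_defect_delta.
rewrite /theta_defect /divchi !sum_fibers -/(box3 B) /=.
(* The bound on d e left by [sum_fibers] follows from the equation. *)
rewrite (eq_bigl (fun t => [&& 0 < t.2.1, 0 < t.2.2 & t.1 ^+ 2 + t.2.1 * t.2.2 == n])).
  rewrite [X in _ * (_ - X)](eq_bigl (fun t : int * (int * int) =>
    [&& 0 < t.2.1, 0 < t.2.2 & t.1 ^+ 2 + 2 * (t.2.1 * t.2.2) == n])).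
    have /= e := liouville_identity _ _ nB. 
    by apply/eqP; rewrite mulrBr addrACA -opprD subr_eq0 addrC e addrC.
  case=> i [d e] /=; rewrite -!andbA; case: ltP => //= d0; case: ltP => //= e0.
  have := mulr_gt0 d0 e0; have := sqr_ge0 i; lia.
case=> i [d e] /=; rewrite -!andbA; case: ltP => //= d0; case: ltP => //= e0.
have := mulr_gt0 d0 e0; have := sqr_ge0 i; lia.
Qed.

(** By strong induction: if f vanishes below n, the defect at n is f(n), from i = 0 in the first
    sum, since 2m <= n forces m < n in the second. *)
Lemma theta_defect_eq0 B (f : int -> int) (N : nat) :
  (4 * N <= B)%N -> (forall m, m < 0 -> f m = 0) -> f 0 = 0 ->
  (forall n : int, 0 < n -> n <= N%:Z -> theta_defect B f n = 0) ->
  forall n : nat, (n <= N)%N -> f n%:Z = 0.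
Proof.
move=> NB fneg f0 fN; elim/ltn_ind => n IH nN.
have [->//|n0] := eqVneq n 0%N.
have flt m : m < n%:Z -> f m = 0.
  move=> mn; have [m0|m0] := ltP m 0; first exact: fneg.
  by rewrite (_ : m = (absz m)%:Z) ?IH//; lia.
have <- : theta_defect B f n = 0 by apply: fN; lia.
rewrite /theta_defect [X in _ - X]big1 ?subr0; last first.
  move=> i _; rewrite big1// => m /eqP e; rewrite flt ?mulr0//.
  by have := sqr_ge0 i; lia.
rewrite (bigD1_seq 0) ?box_uniq ?mem_box//= [X in _ + X]big1 ?addr0; last first.
  move=> i i0; rewrite big1// => m /eqP e; rewrite flt ?mulr0//.
  by have := ler_norm_sqr i; lia.
rewrite big_mkcond (bigD1_seq n%:Z) ?box_uniq ?mem_box//=; last lia.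
rewrite expr0n add0r eqxx mul1r big1 ?addr0// => m mn.
by rewrite add0r (negPf mn).
Qed.

(** Jacobi's theorem: the difference has zero defect for 0 < m <= n, and both sides agree at 0 and
    at negative integers. *)
Lemma repr_jacobi B (n : nat) : (4 * n <= B)%N -> repr B n = jacobi B n.
Proof.
move=> nB; suff : repr B n%:Z + -1 * jacobi B n%:Z = 0 by lia.
apply: (theta_defect_eq0 B (fun m => repr B m + -1 * jacobi B m) n) => //.
- move=> m m0; rewrite /repr /jacobi /divchi !big1.
  + by rewrite mulr0 addr0 lt_eqF.
  + by case=> d e /= /andP[/andP[d0 e0] /eqP e1]; have := mulr_gt0 d0 e0; lia.
  + by case=> a b /= /eqP e1; have := sqr_ge0 a; have := sqr_ge0 b; lia.
- rewrite /repr /jacobi /divchi big_mkcond (bigD1_seq (0, 0)) ?box2_uniq ?mem_box2//=.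
  rewrite !big1//.
    case=> d e /= /andP[/andP[d0 e0] /eqP e1]; have := mulr_gt0 d0 e0; lia.
  case=> a b h /=; case: eqP => // e1; case/eqP: h.
  by have := ler_norm_sqr a; have := ler_norm_sqr b => ? ?; congr (_, _); lia.
- move=> m m0 mn; rewrite theta_defect_linear theta_defect_repr ?theta_defect_jacobi//; lia.
Qed.

(** * Counting lattice points in a disc *)

Lemma sum_levels (T : eqType) (s : seq T) (P : pred T) (g : T -> int) (w : T -> int) N :
  \sum_(1 <= m < N.+1) \sum_(x <- s | P x && (g x == m%:Z)) w x =
  \sum_(x <- s | P x && (0 < g x <= N%:Z)) w x.
Proof.
rewrite (exchange_big_dep P) /=; last by move=> ? ? _ /andP[].
rewrite [RHS]big_mkcondr; apply: eq_bigr => x -> /=.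
case: ifPn => gx; last first.
  by rewrite big_seq_cond big1// => m /andP[]; rewrite mem_index_iota; lia.
rewrite big_mkcond (bigD1_seq (absz (g x))) ?iota_uniq ?mem_index_iota//=; last lia.
rewrite ifT; last lia.
by rewrite big1 ?addr0// => m ?; rewrite ifF//; lia.
Qed.

(** Count pairs (d, e) with d e <= N: for fixed d, e runs up to floor(N/d), and [sum_chi] evaluates
    the inner sum. *)
Lemma sum_divchi B N : (N <= B)%N ->
  \sum_(1 <= m < N.+1) divchi B m =
  \sum_(1 <= k < N.+1) ((N %/ k %% 4)%N \in [:: 1%N; 2%N])%:Z.
Proof.
move=> NB; rewrite sum_levels sum_box2 /= -[RHS](sum_box_nat B N (fun d =>
  ((N %/ absz d %% 4)%N \in [:: 1%N; 2%N])%:Z))//.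
rewrite [RHS]big_mkcond; apply: eq_bigr => d _.
case: ifPn => [/andP[d0 dN]|dN]; last first.
  rewrite big1// => e /andP[/andP[d0 e0] /andP[_ h]].
  have : d <= d * e by rewrite ler_peMr; lia.
  lia.
rewrite -sum_chi -(sum_box_nat B); last by rewrite (leq_trans (leq_div _ _)).
apply: eq_bigl => e; rewrite d0 /=; case: ltP => //= e0.
rewrite mulr_gt0//=.
have -> : d = (absz d)%:Z by lia.
have -> : e = (absz e)%:Z by lia.
rewrite -PoszM !lez_nat leq_divRL; last lia.
by rewrite mulnC.
Qed.

Lemma card_disc B N : (4 * N <= B)%N ->
  \sum_(x <- box2 B | x.1 ^+ 2 + x.2 ^+ 2 <= N%:Z) 1 =
  1 + 4 * \sum_(1 <= k < N.+1) ((N %/ k %% 4)%N \in [:: 1%N; 2%N])%:Z.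
Proof.
move=> NB; rewrite -(sum_divchi B); last lia.
(* The origin supplies the 1; every other point lies on a level m > 0. *)
rewrite big_mkcond (bigD1_seq (0, 0)) ?box2_uniq ?mem_box2//=; congr (_ + _).
rewrite big_distrr /=; transitivity (\sum_(1 <= m < N.+1) repr B m).
  rewrite sum_levels big_mkcond [RHS]big_mkcond; apply: eq_bigr => -[a b] _ /=.
  have [[-> ->]//|ab0] := eqVneq (a, b) (0, 0).
  suff -> : 0 < a ^+ 2 + b ^+ 2 by [].
  have [a0|a0] := eqVneq a 0; last by have := ler_norm_sqr a; have := sqr_ge0 b; lia.
  have [b0|b0] := eqVneq b 0; last by have := ler_norm_sqr b; have := sqr_ge0 a; lia.
  by rewrite a0 b0 eqxx in ab0.
rewrite big_seq [RHS]big_seq; apply: eq_bigr => m; rewrite mem_index_iota => hm.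
rewrite repr_jacobi; last lia.
rewrite /jacobi (_ : (m%:Z == 0) = false) ?add0r//; lia.
Qed.

(** * From floors to nearest integers *)

(** n/k + 1/2 is half of 2n/k + 1, and taking the floor of 2n/k first does not change the floor of
    the half. *)
Lemma nint_div (R : realType) (n k : nat) : (0 < k)%N ->
  nint (n%:R / k%:R : R) = (((2 * n) %/ k).+1 %/ 2)%N%:Z.
Proof.
move=> k0; apply: floor_def.
set z := (_ %/ 2)%N.
have /andP[h1 h2] : (z * (2 * k) <= 2 * n + k < z.+1 * (2 * k))%N.
  have := divn_eq (2 * n) k; have := ltn_pmod (2 * n) k0.
  have := divn_eq ((2 * n) %/ k).+1 2; have := ltn_pmod ((2 * n) %/ k).+1 (isT : (0 < 2)%N).
  rewrite -/z; move: ((2 * n) %/ k)%N ((2 * n) %% k)%N (_ %% 2)%N => q r s.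
  nia.
have kR : 0 < k%:R :> R by rewrite ltr0n.
have -> : n%:R / k%:R + 2^-1 = (2 * n + k)%N%:R / (2 * k)%N%:R :> R.
  by rewrite natrD !natrM; field; rewrite gt_eqF.
rewrite ler_pdivlMr ?ltr_pdivrMr ?ltr0n ?muln_gt0//.
rewrite (_ : z%:Z + 1 = z.+1%:Z); last lia.
by rewrite -!pmulrn -!natrM ler_nat ltr_nat h1.
Qed.

Lemma odd_nint_count_sum (R : realType) n :
  \sum_(1 <= k < (2 * n).+1) ((2 * n %/ k %% 4)%N \in [:: 1%N; 2%N])%:Z =
  (odd_nint_count R n + n)%N%:Z.
Proof.
rewrite (@big_cat_nat _ _ _ n.+1)//=; last lia.
rewrite PoszD; congr (_ + _).
  rewrite /odd_nint_count [in RHS]big_mkcond /= (big_morph Posz PoszD (erefl _)).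
  rewrite big_nat [RHS]big_nat; apply: eq_bigr => k /andP[k0 _].
  rewrite nint_div// !inE; move: (_ %/ k)%N => q; case: ifP => ?; lia.
rewrite (eq_big_nat _ _ (F2 := fun=> 1)); last first.
  move=> k hk; rewrite (_ : (2 * n %/ k = 1)%N)//.
  (* The quotient is 1 because n < k <= 2n gives 0 <= 2n - k < k. *)
  rewrite [X in (X %/ _)%N](_ : _ = 1 * k + (2 * n - k))%N; last lia.
  by rewrite divnMDl ?divn_small//; lia.
rewrite sumr_const_nat; lia.
Qed.

Lemma disc_int_card (R : realType) (n : nat) :
  ([set p : int * int | p.1 ^+ 2 + p.2 ^+ 2 <= 2 * n%:Z]
     #= `I_(4 * odd_nint_count R n + 4 * n + 1)).
Proof.
(* The least box that [card_disc] allows for squared radius 2n. *)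
set B := (4 * (2 * n))%N.
set s : seq (int * int) := [seq p <- box2 B | p.1 ^+ 2 + p.2 ^+ 2 <= (2 * n)%N%:Z].
have -> : [set p : int * int | p.1 ^+ 2 + p.2 ^+ 2 <= 2 * n%:Z] = [set` [fset p in s]%fset].
  apply/seteqP; split=> -[a b] /=; rewrite !inE mem_filter mem_box2 /= PoszM; last first.
    by case/andP.
  move=> h; rewrite h /=.
  have := ler_norm_sqr a; have := ler_norm_sqr b; have := sqr_ge0 a; have := sqr_ge0 b.
  lia.
apply/card_eq_fsetP.
rewrite card_fseq undup_id ?filter_uniq ?box2_uniq//.
have := card_disc B (2 * n) (leqnn _).
rewrite (odd_nint_count_sum R) -big_filter -/s.
rewrite (_ : \sum_(i <- s) 1 = (size s)%:Z).
  by move=> e; apply/eqP; rewrite -eqz_nat [eqbLHS]e; lia.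
by rewrite -sum1_size (big_morph Posz PoszD (erefl _)).
Qed.

Theorem proposition3p5 (R : realType) (n : nat) (hn : (0 < n)%N) :
  (lattice_points_in_disc (Num.sqrt (2 * n%:R : R))
     #= `I_(4 * odd_nint_count R n + 4 * n + 1)) /\
  ([set p : int * int | p.1 ^+ 2 + p.2 ^+ 2 <= 2 * n%:Z]
     #= `I_(4 * odd_nint_count R n + 4 * n + 1)).
Proof.
have int_card := disc_int_card R n; split=> //.
(* Comparing the two square roots amounts to comparing the integers under them. *)
rewrite (_ : lattice_points_in_disc _ =
  [set p : int * int | p.1 ^+ 2 + p.2 ^+ 2 <= 2 * n%:Z])//.
rewrite /lattice_points_in_disc; apply/seteqP; split=> -[a b] /=;
  by rewrite ler_sqrt ?mulr_ge0 ?ler0n// -!rmorphXn -rmorphD /=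
     -[n%:R]/(n%:~R) -(intrM _ 2) ler_int.
Qed.
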